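(* For all integers $n\geq 0$ and all integers $k$ with $1\leq k\leq 10$, $$B_{2,8}(8(11n+k)+7)\equiv 0\pmod{11}.$$
   Context: For integers $l,m>1$, an $l$-regular partition is a partition none of whose parts is divisible by $l$. A $(l,m)$-regular bipartition of $n$ is a pair of partitions $(\lambda,\mu)$ such that the sum of all parts of $\lambda$ and $\mu$ is $n$, $\lambda$ is $l$-regular and $\mu$ is $m$-regular. $B_{l,m}(n)$ denotes the number of $(l,m)$-regular bipartitions of $n$; equivalently $\sum_{n\ge 0}B_{l,m}(n)q^n=\frac{f_lf_m}{f_1^2}$, where $f_k=\prod_{j\ge1}(1-q^{jk})$. *)

(* Defs.v *)
From mathcomp Require Import all_boot.

Set Implicit Arguments.
Unset Strict Implicit.
Unset Printing Implicit Defensive.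

Definition is_partition (s : seq nat) : bool :=
  sorted geq s && all (fun i => 0 < i) s.

Definition regular (l : nat) (s : seq nat) : bool :=
  all (fun i => ~~ (l %| i)) s.

Definition regular_bipartition (l m n : nat) (p : seq nat * seq nat) : bool :=
  [&& is_partition p.1, is_partition p.2, sumn p.1 + sumn p.2 == n,
      regular l p.1 & regular m p.2].

(* A partition of at most n has at most n parts, each of them at most n, so    *)
(* it lies in the finite type {bseq n of 'I_n.+1}; no bipartition of n is lost *)
(* by this bound (lemma B_correct).                                            *)
Definition bounded_seq (n : nat) (s : {bseq n of 'I_n.+1}) : seq nat :=
  map val s.

Definition B (l m n : nat) : nat :=
  #|[set p : {bseq n of 'I_n.+1} * {bseq n of 'I_n.+1} |
      regular_bipartition l m n (bounded_seq p.1, bounded_seq p.2)]|.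

Lemma bounded_seq_inj n : injective (@bounded_seq n).
Proof. by move=> s t /(inj_map val_inj) /val_inj. Qed.

Lemma bounded_seq_onto n (s : seq nat) :
  is_partition s -> sumn s <= n -> exists t : {bseq n of 'I_n.+1}, bounded_seq t = s.
Proof.
case/andP=> _ s_gt0 le_sn.
have le_size : size s <= n.
  apply: leq_trans le_sn; elim: s s_gt0 => //= x s IHs /andP[x0 /IHs le_ss].
  by rewrite -add1n leq_add.
have le_part x : x \in s -> x < n.+1.
  rewrite ltnS => xs; apply: leq_trans le_sn; elim: s xs {s_gt0 le_size} => //=.
  move=> y s IHs; rewrite inE => /orP[/eqP-> | /IHs le_xs].
    exact: leq_addr.
  exact: leq_trans le_xs (leq_addl _ _).
have le_size' : size (map (@inord n) s) <= n by rewrite size_map.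
exists (Bseq le_size').
rewrite /bounded_seq /= -map_comp map_id_in // => x /le_part.
exact: inordK.
Qed.

Lemma B_correct l m n :
  exists e : seq (seq nat * seq nat),
    [/\ uniq e, e =i regular_bipartition l m n & size e = B l m n].
Proof.
pose f (p : {bseq n of 'I_n.+1} * {bseq n of 'I_n.+1}) :=
  (bounded_seq p.1, bounded_seq p.2).
pose A := [set p | regular_bipartition l m n (f p)].
have f_inj : injective f.
  by move=> [s t] [s' t'] [/bounded_seq_inj-> /bounded_seq_inj->].
exists (map f (enum A)); split; last by rewrite size_map -cardE.
  by rewrite map_inj_uniq ?enum_uniq.
move=> [s t]; apply/mapP/idP => [[p] | st].
  by rewrite mem_enum inE => pA ->.
have /and5P[/= s_part t_part /eqP def_n _ _] := st.
have le_sn : sumn s <= n by rewrite -def_n leq_addr.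
have le_tn : sumn t <= n by rewrite -def_n leq_addl.
have [s' def_s] := bounded_seq_onto s_part le_sn.
have [t' def_t] := bounded_seq_onto t_part le_tn.
have f_st : f (s', t') = (s, t) by rewrite /f /= def_s def_t.
by exists (s', t'); rewrite ?mem_enum ?inE f_st.
Qed.

(* Main.v *)
Require Import Defs.
From mathcomp Require Import all_boot.
From mathcomp Require Import all_order all_algebra.
From mathcomp Require Import ring zify.

(* Write f_k for the product of the 1 - q^(jk), theta(q) for the sum of q^(n^2) *)
(* over all integers n and psi(q) for the sum of q^(n(n+1)/2) over n >= 0.      *)
(* Gauss's identities theta(-q) = f_1^2/f_2 and psi(q) = f_2^2/f_1 give         *)
(*   f_2/f_1^2 = 1/theta(-q)                                                    *)
(*             = theta(q) theta(q^2)^2 theta(q^4)^4 / theta(-q^8)^8,            *)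
(* and the dissections theta(q) = theta(q^4) + 2q psi(q^8) and                  *)
(* theta(q)^2 = theta(q^2)^2 + 4q psi(q^4)^2 show that the exponents 7 mod 8 in *)
(* the numerator contribute exactly 64 q^7 psi(q^8)^7. Hence the generating     *)
(* function of B_{2,8}(8N+7) is 64 f_2^22/f_1^22, which modulo 11 is            *)
(* 64 f_22^2/f_11^2, a series in q^11.                                          *)
(*   Power series are evaluated at a nilpotent element q (q^M = 0) of an        *)
(* arbitrary commutative ring, so that the substitutions q -> q^k and q -> -q   *)
(* are mere instances (f_k is euler M (q ^+ k)); at the end q is the class of X *)
(* in F_11[X]/(X^M).                                                            *)

(** Let x be the generating function f_2 f_8/f_1^2, obtained by counting in [B_gf_euler]. Clearing
    the theta quotient by f_8^22 ([theta_dissect], [bipartition_dissect]) leaves a part whose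
    exponents avoid 7 mod 8, plus 64 q^7 f_16^22. In characteristic 11 Frobenius ([euler_frobenius])
    turns f_8^22 and f_16^22 into f_88^2 and f_176^2, so the exponents 7 mod 8 of x all have the
    form 7 + 88j ([bipartition_dissect11]). Hence the coefficient at 8N+7 vanishes unless 11 divides
    N ([B_2_8_pchar11]), and N = 11n+k is never such a multiple. *)

Set Implicit Arguments.
Unset Strict Implicit.
Unset Printing Implicit Defensive.

Import GRing.Theory.
Local Open Scope ring_scope.

(** * Finite forms of Gauss's identities *)

(* Shanks's finite forms of Gauss's identities, cleared of denominators: the   *)
(* terms s > 0 on the right only involve powers above q^n (resp. q^(2n)).       *)
Lemma euler_theta_sum (R : comNzRingType) (q : R) n :
  (\prod_(0 <= k < n) (1 + q ^+ k.+1)) *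
    (1 + 2 * \sum_(0 <= s < n) (-1) ^+ s.+1 * q ^+ (s.+1 ^ 2)) =
  \sum_(0 <= s < n.+1) (-1) ^+ s * q ^+ (s * n.+1) *
    \prod_(s <= k < n) (1 - q ^+ k.+1) * \prod_(0 <= k < s) (1 + q ^+ k).
Proof.
elim: n => [|n IHn]; first by rewrite !big_nat1 !big_nil; ring.
(* Passing from n to n+1 multiplies each summand by 1 + q^(n+1), up to the remainder displayed in
   [shift]; the partial sums of these remainders have a closed form. *)
have telescope m : (m <= n)%N ->
    \sum_(0 <= s < m) (-1) ^+ s * q ^+ (s * n.+1) *
      (\prod_(s <= k < n) (1 - q ^+ k.+1)) * (\prod_(0 <= k < s) (1 + q ^+ k)) *
      ((1 - q ^+ n.+1) * q ^+ s - (1 + q ^+ n.+1)) =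
    (-1) ^+ m * q ^+ (m * n.+1) * (1 - q ^+ m) *
      (\prod_(m <= k < n) (1 - q ^+ k.+1)) * (\prod_(0 <= k < m) (1 + q ^+ k)).
  elim: m => [|m IHm] le_mn; first by rewrite big_nil subrr mulr0 !mul0r.
  rewrite big_nat_recr //= IHm 1?ltnW // (big_ltn le_mn) [in RHS]big_nat_recr //=.
  rewrite mulSn !exprD !exprS; ring.
have shift s : (0 <= s < n.+1)%N ->
    (-1) ^+ s * q ^+ (s * n.+2) * (\prod_(s <= k < n.+1) (1 - q ^+ k.+1)) *
      (\prod_(0 <= k < s) (1 + q ^+ k)) =
    (1 + q ^+ n.+1) * ((-1) ^+ s * q ^+ (s * n.+1) *
      (\prod_(s <= k < n) (1 - q ^+ k.+1)) * (\prod_(0 <= k < s) (1 + q ^+ k))) +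
    (-1) ^+ s * q ^+ (s * n.+1) *
      (\prod_(s <= k < n) (1 - q ^+ k.+1)) * (\prod_(0 <= k < s) (1 + q ^+ k)) *
      ((1 - q ^+ n.+1) * q ^+ s - (1 + q ^+ n.+1)).
  move=> /andP[_ le_sn].
  rewrite big_nat_recr //= [(s * n.+2)%N]mulnS exprD !exprS; ring.
(* The factor 1 + q^0 = 2 is the source of the coefficient 2 in theta. *)
have prodS : (\prod_(0 <= k < n) (1 + q ^+ k)) * (1 + q ^+ n) =
    2 * \prod_(0 <= k < n) (1 + q ^+ k.+1).
  by rewrite -(big_nat_recr n 0) // big_nat_recl // expr0.
rewrite [RHS]big_nat_recr //= (eq_big_nat _ _ shift) big_split /= -mulr_sumr -IHn.
rewrite [in X in _ = _ + X + _]big_nat_recr //= telescope //.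
rewrite ![\prod_(_ <= k < _) (1 - _)]big_geq // !big_nat_recr //=.
rewrite [(n.+1 * n.+2)%N]mulnS exprD -mulnn mulSn mulnS !exprD !exprS.
apply/subr0_eq; set d := (X in X = 0).
(* [ring] sees the two products as unrelated atoms, so the difference is exhibited as a multiple of
   [prodS]. *)
suff ->: d = (-1) ^+ n * q ^+ n.+1 * q ^+ n * q ^+ (n * n) * (1 + q ^+ n.+1) *
    ((\prod_(0 <= k < n) (1 + q ^+ k)) * (1 + q ^+ n) -
     2 * \prod_(0 <= k < n) (1 + q ^+ k.+1)) by rewrite prodS subrr mulr0.
rewrite {}/d exprS; ring.
Qed.

(** Same induction as for [euler_theta_sum], with multiplier 1 - q^(2n+1); the telescoped remainder
    and the new summand together supply the two new triangular exponents. *)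
Lemma euler_psi_sum (R : comNzRingType) (q : R) n :
  (\prod_(0 <= k < n) (1 - q ^+ k.*2.+1)) * (\sum_(0 <= s < n.*2) q ^+ 'C(s.+1, 2)) =
  \sum_(0 <= s < n) q ^+ (s * n.*2.+1) *
    \prod_(s <= k < n) (1 - q ^+ k.*2.+2) * \prod_(0 <= k < s) (1 - q ^+ k.*2.+1).
Proof.
elim: n => [|n IHn]; first by rewrite !big_nil mulr0.
have telescope m : (m <= n)%N ->
    \sum_(0 <= s < m) q ^+ (s * n.*2.+1) *
      (\prod_(s <= k < n) (1 - q ^+ k.*2.+2)) *
      (\prod_(0 <= k < s) (1 - q ^+ k.*2.+1)) *
      ((1 - q ^+ n.*2.+2) * q ^+ s.*2 - (1 - q ^+ n.*2.+1)) =
    q ^+ (m * n.*2.+1) * (1 - q ^+ m.*2) *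
      (\prod_(m <= k < n) (1 - q ^+ k.*2.+2)) *
      (\prod_(0 <= k < m) (1 - q ^+ k.*2.+1)).
  elim: m => [|m IHm] le_mn; first by rewrite big_nil subrr mulr0 !mul0r.
  rewrite big_nat_recr //= IHm 1?ltnW // (big_ltn le_mn) [in RHS]big_nat_recr //=.
  rewrite mulSn !doubleS !exprD !exprS; ring.
have shift s : (0 <= s < n)%N ->
    q ^+ (s * n.+1.*2.+1) * (\prod_(s <= k < n.+1) (1 - q ^+ k.*2.+2)) *
      (\prod_(0 <= k < s) (1 - q ^+ k.*2.+1)) =
    (1 - q ^+ n.*2.+1) * (q ^+ (s * n.*2.+1) *
      (\prod_(s <= k < n) (1 - q ^+ k.*2.+2)) *
      (\prod_(0 <= k < s) (1 - q ^+ k.*2.+1))) +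
    q ^+ (s * n.*2.+1) *
      (\prod_(s <= k < n) (1 - q ^+ k.*2.+2)) *
      (\prod_(0 <= k < s) (1 - q ^+ k.*2.+1)) *
      ((1 - q ^+ n.*2.+2) * q ^+ s.*2 - (1 - q ^+ n.*2.+1)).
  move=> /andP[_ /ltnW le_sn]; rewrite doubleS big_nat_recr //=.
  rewrite !mulnS -[in q ^+ s.*2]addnn !exprD !exprS; ring.
rewrite [RHS]big_nat_recr //= (eq_big_nat _ _ shift) big_split /= -mulr_sumr -IHn.
rewrite telescope // [\prod_(n <= k < n) _]big_geq // [\prod_(n <= k < n.+1) _]big_nat1.
rewrite doubleS !big_nat_recr //=.
have bin_odd: 'C(n.*2.+1, 2) = (n * n.*2.+1)%N.
  by rewrite bin2odd ?oddS ?odd_double //= doubleK mulnC.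
rewrite ['C(n.*2.+2, 2)]binS bin1 bin_odd !mulnS -!addnn !exprD !exprS !exprD; ring.
Qed.

(** * Truncated products and series at a nilpotent element *)

Definition euler (R : comNzRingType) (M : nat) (q : R) : R :=
  \prod_(0 <= k < M) (1 - q ^+ k.+1).

Definition theta (R : comNzRingType) (M : nat) (q : R) : R :=
  1 + 2 * \sum_(0 <= s < M) q ^+ (s.+1 ^ 2).

Definition psi (R : comNzRingType) (M : nat) (q : R) : R :=
  \sum_(0 <= s < M) q ^+ 'C(s.+1, 2).

Definition euler_inv (R : comNzRingType) (M : nat) (q : R) : R :=
  \prod_(0 <= k < M) \sum_(0 <= i < M) (q ^+ k.+1) ^+ i.

Lemma expr_nil (R : comNzRingType) (q : R) M i : q ^+ M = 0 -> (M <= i)%N -> q ^+ i = 0.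
Proof. by move=> qM /subnK <-; rewrite exprD qM mulr0. Qed.

Lemma nilX (R : comNzRingType) (q : R) M k : q ^+ M = 0 -> (0 < k)%N -> (q ^+ k) ^+ M = 0.
Proof. by move=> qM k0; rewrite -exprM (expr_nil qM) // leq_pmull. Qed.

Lemma nilN (R : comNzRingType) (q : R) M : q ^+ M = 0 -> (- q) ^+ M = 0.
Proof. by move=> qM; rewrite exprNn qM mulr0. Qed.

Lemma sum_nat_stable (V : nmodType) (F : nat -> V) M n :
  (M <= n)%N -> (forall i, (M <= i)%N -> F i = 0) ->
  \sum_(0 <= i < n) F i = \sum_(0 <= i < M) F i.
Proof.
move=> le_Mn F0; rewrite (big_cat_nat (leq0n M) le_Mn) /= [X in _ + X = _]big_nat_cond.
by rewrite [X in _ + X = _]big1 ?addr0 // => i /andP[/andP[/F0]].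
Qed.

(** Allows 2M factors in place of M, as needed when exponents are sorted by parity. *)
Lemma euler_stable (R : comNzRingType) (q : R) M n :
  q ^+ M = 0 -> (M <= n)%N -> euler n q = euler M q.
Proof.
move=> qM le_Mn; rewrite /euler (big_cat_nat (leq0n M) le_Mn) /= [X in _ * X = _]big_nat_cond.
rewrite [X in _ * X = _]big1 ?mulr1 // => i /andP[/andP[le_Mi _] _].
by rewrite (expr_nil qM) ?subr0 ?leqW.
Qed.

Lemma theta_stable (R : comNzRingType) (q : R) M n :
  q ^+ M = 0 -> (M <= n)%N -> theta n q = theta M q.
Proof.
move=> qM le_Mn; rewrite /theta (sum_nat_stable le_Mn) // => i le_Mi.
by rewrite (expr_nil qM) // (leq_trans le_Mi) // -mulnn mulnS leqW ?leq_addr.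
Qed.

Lemma psi_stable (R : comNzRingType) (q : R) M n :
  q ^+ M = 0 -> (M <= n)%N -> psi n q = psi M q.
Proof.
move=> qM le_Mn; rewrite /psi (sum_nat_stable le_Mn) // => i le_Mi.
by rewrite (expr_nil qM) // (leq_trans le_Mi) // binS bin1 leq_addl.
Qed.

Lemma euler_invK (R : comNzRingType) (q : R) M :
  q ^+ M = 0 -> euler M q * euler_inv M q = 1.
Proof.
move=> qM; rewrite /euler /euler_inv -big_split /= big1 // => k _.
by rewrite big_mkord -opprB mulNr -subrX1 nilX // sub0r opprK.
Qed.

(** The f_k are units, so identities between quotients are proved with denominators cleared and then
    cancelled, over any commutative ring. *)
Lemma euler_mulI (R : comNzRingType) (q : R) M n : q ^+ M = 0 ->
  injective ( *%R (euler M q ^+ n)).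
Proof.
move=> qM x y eq_xy; have eq1 : euler_inv M q ^+ n * euler M q ^+ n = 1.
  by rewrite mulrC -exprMn euler_invK ?expr1n.
by rewrite -[x]mul1r -[y]mul1r -eq1 -!mulrA eq_xy.
Qed.

Lemma prod_odd_even (R : comNzRingType) (F : nat -> R) n :
  (\prod_(0 <= k < n) F k.*2.+1) * (\prod_(0 <= k < n) F k.*2.+2) =
  \prod_(0 <= k < n.*2) F k.+1.
Proof.
elim: n => [|n IHn]; first by rewrite !big_nil mulr1.
by rewrite doubleS !big_nat_recr //= -IHn; ring.
Qed.

Lemma euler_sqr (R : comNzRingType) (q : R) n :
  euler n (q ^+ 2) = \prod_(0 <= k < n) (1 - q ^+ k.*2.+2).
Proof. by apply: eq_bigr => k _; rewrite -exprM mul2n. Qed.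

Lemma euler_odd (R : comNzRingType) (q : R) M : q ^+ M = 0 ->
  (\prod_(0 <= k < M) (1 - q ^+ k.*2.+1)) * euler M (q ^+ 2) = euler M q.
Proof.
move=> qM; rewrite euler_sqr (prod_odd_even (fun k => 1 - q ^+ k)).
by apply: (euler_stable qM); rewrite -addnn leq_addr.
Qed.

(** The sign change affects only the odd exponents j, where (1 - q^j)(1 + q^j) = 1 - q^(2j). *)
Lemma eulerN (R : comNzRingType) (q : R) M : q ^+ M = 0 ->
  euler M (- q) * euler M q * euler M (q ^+ 4) = euler M (q ^+ 2) ^+ 3.
Proof.
move=> qM; rewrite -[euler M q](euler_odd qM) -(euler_odd (nilN qM)) sqrrN.
have <-: (\prod_(0 <= k < M) (1 - (q ^+ 2) ^+ k.*2.+1)) * euler M (q ^+ 4) = euler M (q ^+ 2).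
  by rewrite (exprM q 2 2) euler_odd ?nilX.
set E := euler M (q ^+ 2).
have ->: \prod_(0 <= k < M) (1 - (q ^+ 2) ^+ k.*2.+1) =
    (\prod_(0 <= k < M) (1 - (- q) ^+ k.*2.+1)) * \prod_(0 <= k < M) (1 - q ^+ k.*2.+1).
  rewrite -big_split; apply: eq_bigr => k _ /=.
  by rewrite exprNn -signr_odd oddS odd_double expr1 -exprM mulnC exprM; ring.
ring.
Qed.

Lemma theta_euler_neg (R : comNzRingType) (q : R) M : q ^+ M = 0 ->
  theta M (- q) * euler M (q ^+ 2) = euler M q ^+ 2.
Proof.
move=> qM.
have ->: euler M (q ^+ 2) = (\prod_(0 <= k < M) (1 + q ^+ k.+1)) * euler M q.
  by rewrite /euler -big_split; apply: eq_bigr => k _ /=; rewrite -exprM mulnC exprM; ring.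
have ->: theta M (- q) = 1 + 2 * \sum_(0 <= s < M) (-1) ^+ s.+1 * q ^+ (s.+1 ^ 2).
  congr (1 + 2 * _); apply: eq_bigr => s _.
  by rewrite [LHS]exprNn -signr_odd oddX orFb signr_odd.
(* For n = M every term with s > 0 contains q^(s(M+1)) = 0; the term s = 0 is f_1. *)
rewrite mulrA [X in X * _]mulrC euler_theta_sum big_ltn //.
rewrite [\sum_(1 <= _ < _) _]big_nat_cond [\sum_(1 <= _ < _ | _) _]big1.
  by rewrite [\prod_(0 <= k < 0) _]big_geq // !mul1r mulr1 addr0.
move=> s /andP[/andP[s_gt0 _] _]; rewrite (expr_nil qM) ?mulr0 ?mul0r //.
by rewrite (leq_trans (leqnSn M)) ?leq_pmull.
Qed.

Lemma psi_euler (R : comNzRingType) (q : R) M : q ^+ M = 0 ->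
  psi M q * euler M q = euler M (q ^+ 2) ^+ 2.
Proof.
move=> qM; rewrite -(euler_odd qM) mulrA [X in X * _]mulrC.
rewrite -(@psi_stable _ q M M.*2) // -?addnn ?leq_addr // addnn.
rewrite euler_psi_sum; case: M qM => [|M] qM.
  (* For M = 0 the hypothesis reads 1 = 0. *)
  by rewrite /euler !big_nil mul0r; apply/esym; rewrite expr1n -(expr0 q).
rewrite big_ltn // [\sum_(1 <= _ < _) _]big_nat_cond [\sum_(1 <= _ < _ | _) _]big1.
  by rewrite [\prod_(0 <= k < 0) _]big_geq // mulr1 mul1r addr0 euler_sqr.
move=> s /andP[/andP[s_gt0 _] _]; rewrite (expr_nil qM) ?mulr0 ?mul0r //.
by rewrite (leq_trans _ (leq_pmull _ s_gt0)) // -addnn; lia.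
Qed.

(** * Dissections of theta and of the generating function *)

Lemma theta_split (R : comNzRingType) (q : R) M : q ^+ M = 0 ->
  theta M q = theta M (q ^+ 4) + 2 * q * psi M (q ^+ 8).
Proof.
(* With 2M terms on the left and M on the right the identity is exact for every q: even squares give
   theta(q^4), and (2m+1)^2 = 8 C(m+1,2) + 1 handles the odd ones. *)
move=> qM; rewrite -(theta_stable (n := M.*2) qM) -?addnn ?leq_addr // addnn {qM}.
elim: M => [|M IHM]; first by rewrite /theta /psi !big_nil; ring.
move: IHM; rewrite /theta /psi doubleS !big_nat_recr //= => IHM.
have ->: (q ^+ 4) ^+ (M.+1 ^ 2) = q ^+ (M.*2.+2 ^ 2) by rewrite -exprM; congr (_ ^+ _); lia.
have eM: (8 * 'C(M.+1, 2)).+1 = (M.*2.+1 ^ 2)%N.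
  by have := mul_bin_diag M.+1 1; rewrite -mulnn bin1 /=; nia.
have ->: q ^+ (M.*2.+1 ^ 2) = q * (q ^+ 8) ^+ 'C(M.+1, 2).
  by rewrite -exprM -exprS eM.
rewrite !mulrDr !addrA IHM; ring.
Qed.

Lemma theta_splitN (R : comNzRingType) (q : R) M : q ^+ M = 0 ->
  theta M (- q) = theta M (q ^+ 4) - 2 * q * psi M (q ^+ 8).
Proof.
move=> /nilN /theta_split ->.
have -> : (- q) ^+ 4 = q ^+ 4 by ring.
have -> : (- q) ^+ 8 = q ^+ 8 by ring.
by ring.
Qed.

(** Replace q by -q in [theta_euler_neg] and eliminate f_1(-q) by [eulerN]. *)
Lemma theta_euler (R : comNzRingType) (q : R) M : q ^+ M = 0 ->
  theta M q * euler M q ^+ 2 * euler M (q ^+ 4) ^+ 2 = euler M (q ^+ 2) ^+ 5.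
Proof.
move=> qM; apply: (@euler_mulI _ (q ^+ 2) M 1); first by rewrite nilX.
have := theta_euler_neg (nilN qM); rewrite opprK sqrrN => eqN.
transitivity ((theta M q * euler M (q ^+ 2)) * (euler M q * euler M (q ^+ 4)) ^+ 2).
  by ring.
by rewrite eqN -exprMn mulrA eulerN //; ring.
Qed.

(** Both sides equal f_2^4/f_1^2. *)
Lemma theta_psi (R : comNzRingType) (q : R) M : q ^+ M = 0 ->
  theta M q * psi M (q ^+ 2) = psi M q ^+ 2.
Proof.
move=> qM; have q2M := nilX (k := 2) qM isT; have q4M := nilX (k := 4) qM isT.
have e1 := theta_euler qM; have e2 := psi_euler qM; have e3 := psi_euler q2M.
rewrite -exprM in e3.
apply: (euler_mulI (n := 2) qM); apply: (euler_mulI (n := 2) q4M).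
apply: (euler_mulI (n := 1) q2M).
transitivity ((theta M q * euler M q ^+ 2 * euler M (q ^+ 4) ^+ 2) *
  (psi M (q ^+ 2) * euler M (q ^+ 2))); first by ring.
rewrite e1 e3.
transitivity ((psi M q * euler M q) ^+ 2 * euler M (q ^+ 2) * euler M (q ^+ 4) ^+ 2).
  by rewrite e2; ring.
by ring.
Qed.

(** Both sides equal f_2^4/f_4^2. *)
Lemma theta_mulN (R : comNzRingType) (q : R) M : q ^+ M = 0 ->
  theta M q * theta M (- q) = theta M (- q ^+ 2) ^+ 2.
Proof.
move=> qM; have q2M := nilX (k := 2) qM isT; have q4M := nilX (k := 4) qM isT.
have e1 := theta_euler qM; have e2 := theta_euler_neg qM; have e3 := theta_euler_neg q2M.
rewrite -exprM in e3.
apply: (euler_mulI (n := 2) q4M); apply: (euler_mulI (n := 2) qM).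
apply: (euler_mulI (n := 1) q2M).
transitivity ((theta M q * euler M q ^+ 2 * euler M (q ^+ 4) ^+ 2) *
  (theta M (- q) * euler M (q ^+ 2))); first by ring.
rewrite e1 e2; transitivity (euler M q ^+ 2 * euler M (q ^+ 2) *
  (theta M (- q ^+ 2) * euler M (q ^+ 4)) ^+ 2); last by ring.
by rewrite e3; ring.
Qed.

(* Splitting both factors in theta_mulN expresses theta(-q^2)^2; then add       *)
(* theta(q^2)^2 - theta(-q^2)^2 = 8 q^2 theta(q^8) psi(q^16) = 8 q^2 psi(q^8)^2. *)
Lemma theta_sqr_split (R : comNzRingType) (q : R) M : q ^+ M = 0 ->
  theta M (q ^+ 2) ^+ 2 = theta M (q ^+ 4) ^+ 2 + 4 * q ^+ 2 * psi M (q ^+ 8) ^+ 2.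
Proof.
move=> qM; have q2M := nilX (k := 2) qM isT; have q8M := nilX (k := 8) qM isT.
have e1 := theta_mulN qM; have e2 := theta_psi q8M.
rewrite theta_split // theta_splitN // in e1.
rewrite theta_splitN // -!exprM in e1; rewrite theta_split // -!exprM.
rewrite -!exprM in e2; rewrite -e2.
transitivity ((theta M (q ^+ 8) - 2 * q ^+ 2 * psi M (q ^+ 16)) ^+ 2 +
   8 * q ^+ 2 * (theta M (q ^+ 8) * psi M (q ^+ 16))); first by ring.
rewrite -e1 e2; ring.
Qed.

(* With x = q^8, the r-th entry (r < 7) is the factor of q^r in the dissection  *)
(* of theta(q) theta(q^2)^2 theta(q^4)^4 by exponents modulo 8; here            *)
(* theta(q^4) = a + 2 q^4 b and theta(q^4)^4 = E + 8 q^4 p^4.                   *)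
Definition theta_sections (R : comNzRingType) (M : nat) (x : R) : seq R :=
  let a := theta M (x ^+ 2) in let b := psi M (x ^+ 4) in let p := psi M x in
  let E := theta M x ^+ 4 + 16 * x * psi M (x ^+ 2) ^+ 4 in
  [:: (a ^+ 3 + 12 * a * b ^+ 2 * x) * E +
        8 * p ^+ 4 * x * (6 * a ^+ 2 * b + 8 * b ^+ 3 * x);
      2 * p * ((a ^+ 2 + 4 * x * b ^+ 2) * E + 32 * p ^+ 4 * x * a * b);
      4 * p ^+ 2 * (a * E + 16 * p ^+ 4 * x * b);
      8 * p ^+ 3 * E;
      (6 * a ^+ 2 * b + 8 * b ^+ 3 * x) * E +
        8 * p ^+ 4 * (a ^+ 3 + 12 * a * b ^+ 2 * x);
      2 * p * (4 * a * b * E + 8 * p ^+ 4 * (a ^+ 2 + 4 * x * b ^+ 2));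
      4 * p ^+ 2 * (2 * b * E + 8 * p ^+ 4 * a)].

(** With p = psi(q^8), the class 7 mod 8 arises only from 2qp * 4q^2 p^2 * 8q^4 p^4, since
    theta(q^4) has only exponents 0 and 4 mod 8. *)
Lemma theta_dissect (R : comNzRingType) (q : R) M : q ^+ M = 0 ->
  theta M q * theta M (q ^+ 2) ^+ 2 * theta M (q ^+ 4) ^+ 4 =
  \sum_(0 <= r < 7) q ^+ r * (theta_sections M (q ^+ 8))`_r +
  64 * q ^+ 7 * psi M (q ^+ 8) ^+ 7.
Proof.
move=> qM; have q2M := nilX (k := 2) qM isT; have q4M := nilX (k := 4) qM isT.
have q8M := nilX (k := 8) qM isT.
have e1 := theta_split qM; have e2 := theta_sqr_split qM; have e3 := theta_split q4M.
have e4 := theta_sqr_split q2M; have e5 := theta_psi q8M.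
rewrite -!exprM in e3 e4 e5.
rewrite !big_nat_recr //= big_nil add0r -!exprM.
transitivity ((theta M (q ^+ 4) + 2 * q * psi M (q ^+ 8)) *
  (theta M (q ^+ 4) ^+ 2 + 4 * q ^+ 2 * psi M (q ^+ 8) ^+ 2) *
  (theta M (q ^+ 8) ^+ 4 + 16 * q ^+ 8 * psi M (q ^+ 16) ^+ 4 +
   8 * q ^+ 4 * (theta M (q ^+ 8) * psi M (q ^+ 16)) ^+ 2)).
  by rewrite -e1 -e2 (exprM _ 2 2) e4; ring.
by rewrite e5 e3; ring.
Qed.

Lemma bipartition_dissect (R : comNzRingType) (q x : R) M : q ^+ M = 0 ->
  x * euler M q ^+ 2 = euler M (q ^+ 2) * euler M (q ^+ 8) ->
  x * euler M (q ^+ 8) ^+ 22 =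
  euler M (q ^+ 8) ^+ 7 * euler M (q ^+ 16) ^+ 8 *
  (\sum_(0 <= r < 7) q ^+ r * (theta_sections M (q ^+ 8))`_r) +
  64 * q ^+ 7 * euler M (q ^+ 16) ^+ 22.
Proof.
move=> qM ex; have q2M := nilX (k := 2) qM isT; have q4M := nilX (k := 4) qM isT.
have q8M := nilX (k := 8) qM isT.
have e1 := theta_euler qM; have e2 := theta_euler q2M; have e4 := theta_euler q4M.
have e8 := psi_euler q8M; have eT := theta_dissect qM.
rewrite -!exprM in e2 e4 e8.
set T := _ * _ * _ in eT; set U := \sum_(0 <= r < 7) _ in eT *.
(* The cancelled powers f_1^2 f_2^4 f_4^10 f_8^4 are, apart from f_16^8, the denominators of the
   three theta factors given by [theta_euler]. *)
have eT' : x * euler M (q ^+ 8) ^+ 15 = T * euler M (q ^+ 16) ^+ 8.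
  apply: (euler_mulI (n := 2) qM); apply: (euler_mulI (n := 4) q2M).
  apply: (euler_mulI (n := 10) q4M); apply: (euler_mulI (n := 4) q8M).
  transitivity ((x * euler M q ^+ 2) * euler M (q ^+ 2) ^+ 4 *
    euler M (q ^+ 4) ^+ 10 * euler M (q ^+ 8) ^+ 19); first by ring.
  rewrite ex; transitivity ((theta M q * euler M q ^+ 2 * euler M (q ^+ 4) ^+ 2) *
    (theta M (q ^+ 2) * euler M (q ^+ 2) ^+ 2 * euler M (q ^+ 8) ^+ 2) ^+ 2 *
    (theta M (q ^+ 4) * euler M (q ^+ 4) ^+ 2 * euler M (q ^+ 16) ^+ 2) ^+ 4).
    by rewrite e1 e2 e4; ring.
  by rewrite /T; ring.
transitivity (x * euler M (q ^+ 8) ^+ 15 * euler M (q ^+ 8) ^+ 7); first by ring.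
rewrite eT' eT; transitivity (euler M (q ^+ 8) ^+ 7 * euler M (q ^+ 16) ^+ 8 * U +
  64 * q ^+ 7 * euler M (q ^+ 16) ^+ 8 * (psi M (q ^+ 8) * euler M (q ^+ 8)) ^+ 7).
  by ring.
by rewrite e8; ring.
Qed.

Lemma euler_frobenius (R : comNzRingType) (q : R) p M : p \in [pchar R] ->
  euler M q ^+ p = euler M (q ^+ p).
Proof.
move=> pR; rewrite -(pFrobenius_autE pR) /euler rmorph_prod; apply: eq_bigr => k _.
by rewrite rmorphB rmorph1 /= pFrobenius_autE exprAC.
Qed.

(** * Generating functions of regular partitions and bipartitions *)

(* The l-regular partitions with parts at most k, each of multiplicity less    *)
(* than M; those of weight less than M are all there, and the others vanish in *)
(* the generating function since q^M = 0.                                      *)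
Fixpoint regular_parts (M l k : nat) : seq (seq nat) :=
  if k is k'.+1 then
    if (l %| k)%N then regular_parts M l k'
    else [seq nseq i k ++ s | i <- iota 0 M, s <- regular_parts M l k']
  else [:: [::]].

Lemma regular_parts_sound M l k s : s \in regular_parts M l k ->
  [/\ is_partition s, regular l s & all (geq k) s].
Proof.
elim: k s => [|k IHk] s; first by rewrite inE => /eqP->.
rewrite /=; case: ifPn => lk.
  move=> /IHk[ps rs ks]; split=> //.
  by apply: sub_all ks => x /leqW.
case/allpairsP=> -[i t] /= [_ /IHk[/andP[st t0] rt kt] ->]; split.
- rewrite /is_partition all_cat t0 andbT; apply/andP; split; last by rewrite all_nseq orbT.
  elim: i => [|i IHi] //=; case: i IHi => [|i] /= IHi; last by rewrite leqnn.
  by case: t st kt {rt t0 IHi} => //= x t -> /andP[/leqW -> _].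
- by rewrite /regular all_cat all_nseq lk orbT.
rewrite all_cat all_nseq /= leqnn orbT /=.
by apply: sub_all kt => x /leqW.
Qed.

(** Inverts the concatenation in [regular_parts]: the copies of the largest admissible part come
    first. *)
Lemma sorted_geq_split k s : sorted geq s -> all (geq k.+1) s ->
  s = nseq (count_mem k.+1 s) k.+1 ++ [seq x <- s | x <= k]%N.
Proof.
elim: s => //= x s IHs; rewrite (path_sortedE (rev_trans leq_trans)) => /andP[xs ss] /andP[xk ks].
rewrite {1}(IHs ss ks); case: eqVneq => [->|nx]; first by rewrite ltnn.
have {}xk : (x <= k)%N by move: xk; rewrite /= leq_eqVlt (negPf nx).
rewrite xk; suff -> : count_mem k.+1 s = 0%N by [].
apply/count_memPn; apply/negP => /(allP xs) /=; lia.
Qed.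

Lemma regular_parts_complete M l k s : is_partition s -> regular l s ->
  all (geq k) s -> (sumn s < M)%N -> s \in regular_parts M l k.
Proof.
elim: k s => [|k IHk] s /andP[ss s0] rs ks lt_sM.
  by case: s s0 ks {ss rs lt_sM} => //= -[].
have def_s := sorted_geq_split ss ks.
set t := [seq x <- s | x <= k]%N in def_s.
have tM : (sumn t < M)%N.
  by apply: leq_ltn_trans lt_sM; rewrite [in leqRHS]def_s sumn_cat leq_addl.
have t_in : t \in regular_parts M l k.
  apply: IHk; rewrite ?filter_all //.
  - rewrite /is_partition sorted_filter //; last exact: rev_trans leq_trans.
    by rewrite all_filter; apply: sub_all s0 => x /= ->; rewrite implybT.
  - by rewrite /regular all_filter; apply: sub_all rs => x /= ->; rewrite implybT.
rewrite /=; case: ifPn => lk.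
  suff -> : s = t by [].
  rewrite def_s (count_memPn _) //; apply/negP => /(allP rs).
  by rewrite lk.
rewrite {1}def_s; apply/allpairsP; exists (count_mem k.+1 s, t); split=> //=.
rewrite mem_iota add0n /=; apply: leq_ltn_trans lt_sM.
by rewrite [in leqRHS]def_s sumn_cat sumn_nseq (leq_trans _ (leq_addr _ _)) ?leq_pmull.
Qed.

Lemma regular_parts_uniq M l k : uniq (regular_parts M l k).
Proof.
elim: k => //= k IHk; case: ifP => // _.
apply: allpairs_uniq => //; first exact: iota_uniq.
(* The multiplicity of k+1 recovers i, hence also s. *)
have cnt i s : s \in regular_parts M l k -> count_mem k.+1 (nseq i k.+1 ++ s) = i.
  move=> /regular_parts_sound[_ _ ks]; rewrite count_cat count_nseq /= eqxx mul1n.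
  by rewrite (count_memPn _) ?addn0 //; apply/negP => /(allP ks); rewrite /= ltnn.
move=> [i s] [j t] /allpairsP[[i' s'] /= [_ sP [-> ->]]].
move=> /allpairsP[[j' t'] /= [_ tP [-> ->]]] eq_st.
have eq_ij : i' = j' by rewrite -(cnt i' s') // eq_st cnt.
move: eq_st; rewrite eq_ij => /eqP; rewrite eqseq_cat // => /andP[_ /eqP ->] //.
Qed.

Lemma regular_parts_gf (R : comNzRingType) (q : R) M l k :
  \sum_(s <- regular_parts M l k) q ^+ sumn s =
  \prod_(0 <= j < k | ~~ (l %| j.+1)%N) \sum_(0 <= i < M) (q ^+ j.+1) ^+ i.
Proof.
elim: k => [|k IHk]; first by rewrite big_nil big_seq1.
rewrite [RHS]big_mkcond [RHS]big_nat_recr //= -[in RHS]big_mkcond /= -IHk; case: ifP => _ /=.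
  by rewrite mulr1.
rewrite big_allpairs_dep mulrC mulr_suml /index_iota subn0; apply: eq_bigr => i _.
rewrite mulr_sumr; apply: eq_bigr => s _.
by rewrite sumn_cat sumn_nseq exprD exprM.
Qed.

(** In each block of l consecutive indices only the last is selected. *)
Lemma prod_multiples (R : comNzRingType) (F : nat -> R) l n : (0 < l)%N ->
  \prod_(0 <= j < n * l | (l %| j.+1)%N) F j.+1 = \prod_(0 <= i < n) F (l * i.+1)%N.
Proof.
case: l => // l _; elim: n => [|n IHn]; first by rewrite !big_nil.
rewrite (big_cat_nat (leq0n (n * l.+1))) /=; last by rewrite leq_mul2r leqnSn orbT.
rewrite IHn [RHS]big_nat_recr //=; congr (_ * _).
rewrite mulSn addSn addnC big_mkcond big_nat_recr ?leq_addr //=.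
rewrite -addnS -mulSnr dvdn_mull // [in X in _ * X]mulnC big_nat big1 ?mul1r // => j /andP[lo hi].
case: ifP => // /dvdnP[d ed]; exfalso.
have nd : (n < d)%N by rewrite -(ltn_pmul2r (ltn0Sn l)) -ed.
by have := leq_mul nd (leqnn l.+1); rewrite -ed mulSnr addnS ltnS leqNgt hi.
Qed.

(** Multiplying by f_1 cancels the geometric series of the parts not divisible by l; the factors
    left over form f_l. *)
Lemma regular_gf (R : comNzRingType) (q : R) M l : (0 < l)%N -> q ^+ M = 0 ->
  (\sum_(s <- regular_parts M l M) q ^+ sumn s) * euler M q = euler M (q ^+ l).
Proof.
move=> l0 qM; rewrite regular_parts_gf /euler.
rewrite [X in _ * X](bigID (fun j => ~~ (l %| j.+1)%N)) /= mulrA -big_split /=.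
rewrite big1 => [|j _]; last first.
  by rewrite mulrC big_mkord -opprB mulNr -subrX1 nilX // sub0r opprK.
rewrite mul1r; under eq_bigl do rewrite negbK.
under [RHS]eq_bigr do rewrite -exprM.
rewrite -(prod_multiples (fun j => 1 - q ^+ j) M l0).
have le_M : (M <= M * l)%N by rewrite leq_pmulr.
rewrite [RHS](big_cat_nat (leq0n M) le_M) /= big_nat_cond [X in _ * X]big_nat_cond.
rewrite [X in _ * X]big1 ?mulr1 -?big_nat_cond // => j /andP[/andP[Mj _] _].
by rewrite (expr_nil qM) ?subr0 ?leqW.
Qed.

Lemma B_count l m M n : (n < M)%N ->
  B l m n = count (fun p => sumn p.1 + sumn p.2 == n)%N
    [seq (s, t) | s <- regular_parts M l M, t <- regular_parts M m M].
Proof.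
move=> nM; have [e [e_uniq e_mem <-]] := B_correct l m n.
rewrite -size_filter; apply/perm_size/uniq_perm => //.
  by rewrite filter_uniq // allpairs_uniq ?regular_parts_uniq // => -[s t] [s' t'].
have le_all s : (sumn s <= n)%N -> all (geq M) s.
  move=> sn; apply/allP => x xs /=; apply: leq_trans (ltnW nM); apply: leq_trans sn.
  elim: s xs => //= y s IHs; rewrite inE => /orP[/eqP-> | /IHs xs].
    exact: leq_addr.
  exact: leq_trans xs (leq_addl _ _).
move=> [s t]; rewrite e_mem mem_filter unfold_in /regular_bipartition /=.
apply/and5P/andP => [[ps pt /eqP st rs rt] | [st]].
  split; first by rewrite st.
  apply/allpairsP; exists (s, t); split=> //=; apply: regular_parts_complete => //.
  - by apply: le_all; lia.
  - by lia.
  - by apply: le_all; lia.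
  - by lia.
case/allpairsP=> -[s' t'] /= [/regular_parts_sound[ps rs _] /regular_parts_sound[pt rt _]].
by case=> es et; rewrite es et in st *; split.
Qed.

(** Pairs are grouped by total weight; those of weight at least M occur on the right but contribute
    0. *)
Lemma B_gf (R : comNzRingType) (q : R) l m M : q ^+ M = 0 ->
  \sum_(0 <= n < M) (B l m n)%:R * q ^+ n =
  (\sum_(s <- regular_parts M l M) q ^+ sumn s) *
  (\sum_(t <- regular_parts M m M) q ^+ sumn t).
Proof.
move=> qM; set L := [seq (s, t) | s <- regular_parts M l M, t <- regular_parts M m M].
transitivity (\sum_(p <- L) q ^+ (sumn p.1 + sumn p.2)); last first.
  rewrite big_allpairs mulr_suml; apply: eq_bigr => s _.
  by rewrite mulr_sumr; apply: eq_bigr => t _; rewrite -exprD.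
transitivity (\sum_(0 <= n < M) \sum_(p <- L)
     (if (sumn p.1 + sumn p.2 == n)%N then q ^+ n else 0)).
  apply: eq_big_nat => n /andP[_ nM]; rewrite (B_count _ _ nM) -big_mkcond /=.
  by rewrite -sum1_count natr_sum mulr_suml; apply: eq_bigr => p _; rewrite mul1r.
rewrite exchange_big; apply: eq_bigr => p _ /=.
rewrite big_mkord; have [lt_pM | le_Mp] := ltnP (sumn p.1 + sumn p.2) M.
  rewrite (bigD1 (Ordinal lt_pM)) //= eqxx big1 ?addr0 // => n.
  by rewrite -val_eqE eq_sym /= => /negPf ->.
rewrite (expr_nil qM) // big1 // => n _; case: eqP => // eq_n.
by rewrite eq_n leqNgt ltn_ord in le_Mp.
Qed.

Lemma B_gf_euler (R : comNzRingType) (q : R) l m M : (0 < l)%N -> (0 < m)%N -> q ^+ M = 0 ->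
  (\sum_(0 <= n < M) (B l m n)%:R * q ^+ n) * euler M q ^+ 2 =
  euler M (q ^+ l) * euler M (q ^+ m).
Proof.
move=> l0 m0 qM; rewrite -(regular_gf l0 qM) -(regular_gf m0 qM) B_gf //; ring.
Qed.

(** * Coefficient extraction modulo 11 *)

Lemma euler_rmorph (R S : comNzRingType) (f : {rmorphism R -> S}) M q :
  f (euler M q) = euler M (f q).
Proof.
by rewrite rmorph_prod; apply: eq_bigr => k _; rewrite rmorphB rmorph1 rmorphXn.
Qed.

Lemma euler_inv_rmorph (R S : comNzRingType) (f : {rmorphism R -> S}) M q :
  f (euler_inv M q) = euler_inv M (f q).
Proof.
rewrite rmorph_prod; apply: eq_bigr => k _; rewrite rmorph_sum.
by apply: eq_bigr => i _; rewrite !rmorphXn.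
Qed.

Lemma theta_rmorph (R S : comNzRingType) (f : {rmorphism R -> S}) M q :
  f (theta M q) = theta M (f q).
Proof.
rewrite /theta rmorphD rmorph1 rmorphM rmorph_nat rmorph_sum.
by congr (1 + 2 * _); apply: eq_bigr => k _; rewrite rmorphXn.
Qed.

Lemma psi_rmorph (R S : comNzRingType) (f : {rmorphism R -> S}) M q :
  f (psi M q) = psi M (f q).
Proof. by rewrite rmorph_sum; apply: eq_bigr => k _; rewrite rmorphXn. Qed.

Lemma theta_sections_rmorph (R S : comNzRingType) (f : {rmorphism R -> S}) M x :
  map f (theta_sections M x) = theta_sections M (f x).
Proof.
rewrite /theta_sections /=.
by rewrite !(theta_rmorph, psi_rmorph, rmorphXn, rmorph_nat, rmorphM, rmorphD).
Qed.

Lemma in_qpolyXn_coef (F : fieldType) M (p r : {poly F}) i : (i < M)%N ->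
  in_qpoly 'X^M p = in_qpoly 'X^M r -> p`_i = r`_i.
Proof.
case: M => // M iM /(congr1 val) /=; rewrite mk_monic_Xn /=.
rewrite -!Pdiv.RingMonic.take_poly_rmodp => /(congr1 (fun u : {poly F} => u`_i)).
by rewrite !coef_take_poly iM.
Qed.

(* Modulo 11 the generating function of B_{2,8} is the sum over r < 7 of        *)
(* q^r B_section(q^8), plus q^7 B_last_section(q^88).                           *)
Definition B_section (R : comNzRingType) (M r : nat) (x : R) : R :=
  euler M x ^+ 7 * euler M (x ^+ 2) ^+ 8 * euler_inv M (x ^+ 11) ^+ 2 *
  (theta_sections M x)`_r.

(** Exhibits the value at q^8 as the image of one polynomial in X under X -> q^8, so that its
    exponents can be read off. *)
Lemma B_section_rmorph (R S : comNzRingType) (f : {rmorphism R -> S}) M r x :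
  f (B_section M r x) = B_section M r (f x).
Proof.
rewrite /B_section 3!rmorphM !(rmorphXn, euler_rmorph, euler_inv_rmorph).
rewrite -theta_sections_rmorph; have [r7 | r7] := ltnP r 7; first by rewrite (nth_map 0).
by rewrite !nth_default ?rmorph0.
Qed.

Definition B_last_section (R : comNzRingType) (M : nat) (y : R) : R :=
  64 * (euler M (y ^+ 2) * euler_inv M y) ^+ 2.

Lemma B_last_section_rmorph (R S : comNzRingType) (f : {rmorphism R -> S}) M y :
  f (B_last_section M y) = B_last_section M (f y).
Proof.
by rewrite rmorphM rmorph_nat rmorphXn rmorphM euler_rmorph euler_inv_rmorph rmorphXn.
Qed.

Lemma bipartition_dissect11 (R : comNzRingType) (q x : R) M :
  11 \in [pchar R] -> q ^+ M = 0 ->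
  x * euler M q ^+ 2 = euler M (q ^+ 2) * euler M (q ^+ 8) ->
  x = \sum_(0 <= r < 7) q ^+ r * B_section M r (q ^+ 8) +
    q ^+ 7 * B_last_section M (q ^+ 88).
Proof.
move=> R11 qM ex; have q88M := nilX (k := 88) qM isT.
apply: (euler_mulI (n := 2) q88M); set U := \sum_(0 <= r < 7) _.
have := bipartition_dissect qM ex; set V := \sum_(0 <= r < 7) _.
rewrite -[22%N]/(11 * 2)%N !exprM !(euler_frobenius _ _ R11) -!exprM => eq_x.
rewrite /B_last_section.
have -> : U = euler M (q ^+ 8) ^+ 7 * euler M (q ^+ 16) ^+ 8 *
    euler_inv M (q ^+ 88) ^+ 2 * V.
  by rewrite /U mulr_sumr; apply: eq_bigr => r _; rewrite /B_section -!exprM mulrCA.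
rewrite -exprM mulrC eq_x; apply/esym.
transitivity ((euler M (q ^+ 88) * euler_inv M (q ^+ 88)) ^+ 2 *
  (euler M (q ^+ 8) ^+ 7 * euler M (q ^+ 16) ^+ 8 * V + 64 * q ^+ 7 * euler M (q ^+ 176) ^+ 2)).
  by ring.
by rewrite euler_invK // expr1n mul1r.
Qed.

Lemma B_2_8_pchar11 (F : fieldType) N : 11 \in [pchar F] -> ~~ (11 %| N)%N ->
  (B 2 8 (8 * N + 7))%:R = 0 :> F.
Proof.
move=> F11 N11; set M := (8 * N + 7).+1%N.
pose R := {poly %/ 'X^M : {poly F}}; pose q : R := in_qpoly 'X^M 'X.
have qM : q ^+ M = 0.
  rewrite -rmorphXn; apply/val_inj; rewrite /= mk_monic_Xn.
  by rewrite Pdiv.RingMonic.rmodpp ?monicXn.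
have R11 : 11 \in [pchar R] by rewrite pchar_qpoly.
have := bipartition_dissect11 R11 qM (B_gf_euler (l := 2) (m := 8) isT isT qM).
(* [ev d] sends X to q^d; it lifts the identity in the quotient ring to the explicit polynomial [P],
   equal to the generating function modulo X^M. *)
pose ev d : {rmorphism {poly F} -> R} := in_qpoly 'X^M \o comp_poly 'X^d.
pose P : {poly F} := \sum_(0 <= r < 7) 'X^r * (B_section M r 'X \Po 'X^8) +
  'X^7 * (B_last_section M 'X \Po 'X^88).
have -> : \sum_(0 <= n < M) (B 2 8 n)%:R * q ^+ n =
    in_qpoly 'X^M (\poly_(n < M) (B 2 8 n)%:R).
  rewrite poly_def rmorph_sum big_mkord; apply: eq_bigr => n _.
  by rewrite mulr_natl scaler_nat rmorphMn rmorphXn.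
have evX1 d : ev d 'X = q ^+ d by rewrite /= comp_polyX rmorphXn.
set Q := (X in _ = X -> _); have -> : Q = in_qpoly 'X^M P.
  rewrite rmorphD rmorph_sum rmorphM rmorphXn; congr (_ + _ * _).
    apply: eq_bigr => r _; rewrite rmorphM rmorphXn; congr (_ * _).
    by rewrite -[RHS]/(ev 8 _) B_section_rmorph evX1.
  by rewrite -[RHS]/(ev 88 _) B_last_section_rmorph evX1.
move=> /(in_qpolyXn_coef (ltnSn (8 * N + 7))).
rewrite coef_poly ltnSn => ->.
rewrite coefD coef_sum coefXnM ltnNge leq_addl /= addnK coef_comp_poly_Xn //.
(* The last section would need 88 to divide 8N, that is 11 to divide N; the sections r < 7 would
   need 8N + 7 = r mod 8. *)
rewrite [X in _ + X]ifF ?addr0; last first.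
  by rewrite -[88%N]/(8 * 11)%N dvdn_pmul2l //; apply: negPf.
rewrite big_nat big1 // => r /andP[_ r7]; rewrite coefXnM coef_comp_poly_Xn //.
rewrite ltnNge (leq_trans (ltnW r7)) ?leq_addl //= ifF //.
by apply/negP; lia.
Qed.

Local Close Scope ring_scope.

Theorem theorem1p6 (n k : nat) (hk : 1 <= k <= 10) :
  B 2 8 (8 * (11 * n + k) + 7) = 0 %[mod 11].
Proof.
have k11 : ~~ (11 %| 11 * n + k) by lia.
have char11 := pchar_Fp (isT : prime 11).
have /eqP := B_2_8_pchar11 char11 k11.
by rewrite -(dvdn_pcharf char11) => /eqP ->; rewrite mod0n.
Qed.
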